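(* Let $u(x,t)\in\mathcal{P}$ with $u_3\equiv 0$, and let $\Omega=[0,\Pi_1]\times[0,\Pi_2]\times[0,h]$. Then for all $t\in\mathbb{R}$ $$\frac{d}{dt}\int_{\Omega}|u|^2d^3x+2\nu\int_{\Omega}\sum_{k,l=1}^3\left(\frac{\partial u_k}{\partial x_l}\right)^2d^3x-\nu\int_{\Omega}\left(\left(\frac{\partial u_1}{\partial x_1}\right)^2+\left(\frac{\partial u_2}{\partial x_2}\right)^2\right)d^3x$$ $$\leq\frac{\bar p^2\Pi_1\Pi_2h}{6\nu}+\bar p^{3/2}(\Pi_1+\Pi_2)h+\bar p^{1/2}\sum_{j=1}^2\int_0^{\Pi_{j'}}\int_0^h\langle u_j\rangle_j^2\,dx_3\,dx_{j'},$$ where $j'=3-j$.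
   Context: $\nu,h,\Pi_1,\Pi_2>0$ are constants and $\mathcal{O}=\mathbb{R}\times\mathbb{R}\times[0,h]$. Velocity fields $u=(u_1,u_2,u_3)(x,t)$, $x=(x_1,x_2,x_3)\in\mathcal{O}$, are solutions of the Navier-Stokes equations $\partial_t u+(u\cdot\nabla)u=\nu\Delta u-\nabla P$, $\nabla\cdot u=0$, with no-slip condition $u=0$ at $x_3=0$ and $x_3=h$; here $P=P(x,t)$ is the sum of pressure and a time-independent potential. Such a $u$ belongs to the class $\mathcal{P}$ if: (A.1) $u\in C^\infty(\mathcal{O}\times\mathbb{R})$; (A.2) $u$ is periodic in $x_1$ and $x_2$ with periods $\Pi_1$ and $\Pi_2$; it then follows that $P(x_1+\Pi_1,x_2,x_3,t)-P(x_1,x_2,x_3,t)=:p_1(t)$ and $P(x_1,x_2+\Pi_2,x_3,t)-P(x_1,x_2,x_3,t)=:p_2(t)$ depend only on $t$; (A.3) $u$ exists for all $t\in\mathbb{R}$ and has bounded energy per mass: $\int_0^{\Pi_1}\int_0^{\Pi_2}\int_0^h u\cdot u\,dx<\infty$ for all $t\in\mathbb{R}$; (A.4) there is a constant $\bar p<\infty$ with $0<-p_1(t)\le\bar p$ and $|p_2(t)|\le\bar p$ for all $t\in\mathbb{R}$; (A.5) $\sup_{x_2\in\mathbb{R}}P(x_1,x_2,x_3,t)<\infty$ for all $x_1,x_3,t$. The constant $\bar p$ in the claim is the one in (A.4). For $j=1,2$, $\langle\cdot\rangle_j:=\frac{1}{\Pi_j}\int_0^{\Pi_j}\cdot\,dx_j$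 denotes the average in the $x_j$ direction. *)

(* Defs.v *)
From Stdlib Require Import Reals.
From Coquelicot Require Import Coquelicot.
Open Scope R_scope.

Inductive axis := X1 | X2 | X3.
Inductive coord := Space (i : axis) | Time.
Coercion Space : axis >-> coord.

Definition sum3 (f : axis -> R) : R := f X1 + f X2 + f X3.

(* A space-time point is ((x1, x2, x3), t), written (x1, x2, x3, t). *)
Definition spacetime : Type := (R * R * R * R)%type.

Definition shift (c : coord) (s : R) (p : spacetime) : spacetime :=
  let '(x1, x2, x3, t) := p in
  match c with
  | Space X1 => (x1 + s, x2, x3, t)
  | Space X2 => (x1, x2 + s, x3, t)
  | Space X3 => (x1, x2, x3 + s, t)
  | Time => (x1, x2, x3, t + s)
  end.

(* The closed domain O x R.  Fields are total functions on R^4, but nothing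
   below depends on their values outside of this set. *)
Definition slab (h : R) (p : spacetime) : Prop :=
  let '(_, _, x3, _) := p in 0 <= x3 <= h.

(* The partial derivative relative to the closed domain: only increments that
   stay in the domain are used, so the x3-derivative is one-sided at x3 = 0
   and x3 = h, and is the usual two-sided derivative elsewhere. *)
Definition is_partial (h : R) (c : coord) (f : spacetime -> R)
    (p : spacetime) (l : R) : Prop :=
  filterlim (fun s : R => (f (shift c s p) - f p) / s)
    (within (fun s : R => s <> 0 /\ slab h (shift c s p)) (locally 0))
    (locally l).

Definition ex_partial (h : R) (c : coord) (f : spacetime -> R)
    (p : spacetime) : Prop :=
  exists l : R, is_partial h c f p l.

(* The value of the partial derivative where it exists (cf. RInt). *)
Definition partial_deriv (h : R) (c : coord) (f : spacetime -> R)
    (p : spacetime) : R :=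
  iota (is_partial h c f p).

Fixpoint Ck_slab (h : R) (n : nat) (f : spacetime -> R) : Prop :=
  continuous_on (slab h) f /\
  match n with
  | O => True
  | S m => forall c : coord,
      (forall p, slab h p -> ex_partial h c f p) /\
      Ck_slab h m (partial_deriv h c f)
  end.

Definition smooth_slab (h : R) (f : spacetime -> R) : Prop :=
  forall n : nat, Ck_slab h n f.

(* u is a solution with (generalized) pressure P; no regularity of P is
   required beyond the existence of its gradient. *)
Definition navier_stokes (nu h : R) (u : axis -> spacetime -> R)
    (P : spacetime -> R) : Prop :=
  forall p, slab h p ->
    (forall k : axis,
       ex_partial h k P p /\
       partial_deriv h Time (u k) p + sum3 (fun j => u j p * partial_deriv h j (u k) p)
       = nu * sum3 (fun j => partial_deriv h j (partial_deriv h j (u k)) p)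
         - partial_deriv h k P p) /\
    sum3 (fun k => partial_deriv h k (u k) p) = 0.

Definition no_slip (h : R) (u : axis -> spacetime -> R) : Prop :=
  forall (k : axis) (x1 x2 t : R),
    u k (x1, x2, 0, t) = 0 /\ u k (x1, x2, h, t) = 0.

Definition periodic (h : R) (c : coord) (L : R) (f : spacetime -> R) : Prop :=
  forall p, slab h p -> f (shift c L p) = f p.

(* P(x + L e_i, t) - P(x, t).  It depends only on t, since the gradient of P
   inherits the periodicity of u, and is therefore evaluated at x = 0. *)
Definition pressure_jump (i : axis) (L : R) (P : spacetime -> R) (t : R) : R :=
  P (shift i L (0, 0, 0, t)) - P (0, 0, 0, t).

Definition energy_density (u : axis -> spacetime -> R) (p : spacetime) : R :=
  sum3 (fun k => u k p ^ 2).

Definition int_box (Pi1 Pi2 h : R) (f : spacetime -> R) (t : R) : R :=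
  RInt (fun x1 => RInt (fun x2 => RInt (fun x3 => f (x1, x2, x3, t))
    0 h) 0 Pi2) 0 Pi1.

(* For the real-valued RInt, "the integral is finite" means that every stage
   of the iterated integral exists. *)
Definition ex_int_box (Pi1 Pi2 h : R) (f : spacetime -> R) (t : R) : Prop :=
  (forall x1 x2, 0 <= x1 <= Pi1 -> 0 <= x2 <= Pi2 ->
     ex_RInt (fun x3 => f (x1, x2, x3, t)) 0 h) /\
  (forall x1, 0 <= x1 <= Pi1 ->
     ex_RInt (fun x2 => RInt (fun x3 => f (x1, x2, x3, t)) 0 h) 0 Pi2) /\
  ex_RInt (fun x1 => RInt (fun x2 => RInt (fun x3 => f (x1, x2, x3, t))
    0 h) 0 Pi2) 0 Pi1.

Definition avg1 (Pi1 : R) (f : spacetime -> R) (x2 x3 t : R) : R :=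
  / Pi1 * RInt (fun x1 => f (x1, x2, x3, t)) 0 Pi1.

Definition avg2 (Pi2 : R) (f : spacetime -> R) (x1 x3 t : R) : R :=
  / Pi2 * RInt (fun x2 => f (x1, x2, x3, t)) 0 Pi2.

(* u belongs to the class, as witnessed by the pressure P and the constant
   pbar. *)
Record in_class (nu h Pi1 Pi2 : R) (u : axis -> spacetime -> R)
    (P : spacetime -> R) (pbar : R) : Prop := {
  class_navier_stokes : navier_stokes nu h u P;
  class_no_slip : no_slip h u;
  class_smooth : forall k : axis, smooth_slab h (u k);
  class_periodic : forall k : axis,
    periodic h X1 Pi1 (u k) /\ periodic h X2 Pi2 (u k);
  class_energy : forall t : R, ex_int_box Pi1 Pi2 h (energy_density u) t;
  class_jump : forall t : R,
    0 < - pressure_jump X1 Pi1 P t <= pbar /\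
    Rabs (pressure_jump X2 Pi2 P t) <= pbar;
  class_pressure_bounded : forall x1 x3 t : R, 0 <= x3 <= h ->
    bound (fun y => exists x2 : R, y = P (x1, x2, x3, t))
}.

(* Main.v *)
(** Write [p_j] for the pressure jumps and split the pressure as [P = Q + sum_j (p_j / Pi_j) x_j], so that [Q] is periodic in [x1] and [x2]. The divergence of
    [2 nu sum_k u_k grad u_k - u |u|^2 - 2 u Q]
    equals [d|u|^2/dt + 2 nu |grad u|^2 + 2 sum_j (p_j / Pi_j) u_j], and its integral over the box vanishes by periodicity and the no-slip condition. Hence the first two terms on the left of the claim add up to [- 2 sum_j p_j int int <u_j>_j], and with [s = sqrt pbar] each summand is bounded through [2 s^2 |a| <= s^3 + s a^2]. The remaining terms have the favourable sign.

    All one-sided derivatives at [x3 = 0] and [x3 = h] are handled by clamping [x3] to [[0, h]], which turns functions continuous on the slab into functions continuous everywhere. *)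

Require Import Defs.
From Stdlib Require Import Reals Lra IndefiniteDescription.
From Coquelicot Require Import Coquelicot.
Open Scope R_scope.

(** * Everywhere continuous functions and their closure rules *)

Definition cts {U V : UniformSpace} (f : U -> V) : Prop :=
  forall x, continuous f x.

Section Cts.
Context {U : UniformSpace}.

Lemma cts_id : cts (fun x : U => x).
Proof. intros x; apply continuous_id. Qed.

Lemma cts_const {V : UniformSpace} (c : V) : cts (fun _ : U => c).
Proof. intros x; apply continuous_const. Qed.

Lemma cts_comp {V W : UniformSpace} (g : V -> W) (f : U -> V) :
  cts g -> cts f -> cts (fun x => g (f x)).
Proof. intros Hg Hf x; apply continuous_comp; [apply Hf | apply Hg]. Qed.

Lemma cts_fst {V W : UniformSpace} (f : U -> V * W) :
  cts f -> cts (fun x => fst (f x)).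
Proof.
  intros Hf x; apply (continuous_comp f fst); [apply Hf |].
  destruct (f x); apply continuous_fst.
Qed.

Lemma cts_snd {V W : UniformSpace} (f : U -> V * W) :
  cts f -> cts (fun x => snd (f x)).
Proof.
  intros Hf x; apply (continuous_comp f snd); [apply Hf |].
  destruct (f x); apply continuous_snd.
Qed.

Lemma cts_pair {V W : UniformSpace} (f : U -> V) (g : U -> W) :
  cts f -> cts g -> cts (fun x => (f x, g x)).
Proof.
  intros Hf Hg x.
  apply (continuous_comp_2 f g (fun a b => (a, b))); [apply Hf | apply Hg |].
  apply (continuous_ext (fun p => p)); [intros []; reflexivity | apply continuous_id].
Qed.

Lemma cts_plus (f g : U -> R) : cts f -> cts g -> cts (fun x => f x + g x).
Proof. intros Hf Hg x; apply (continuous_plus f g); [apply Hf | apply Hg]. Qed.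

Lemma cts_opp (f : U -> R) : cts f -> cts (fun x => - f x).
Proof. intros Hf x; apply (continuous_opp f); apply Hf. Qed.

Lemma cts_minus (f g : U -> R) : cts f -> cts g -> cts (fun x => f x - g x).
Proof. intros Hf Hg x; apply (continuous_minus f g); [apply Hf | apply Hg]. Qed.

Lemma cts_mult (f g : U -> R) : cts f -> cts g -> cts (fun x => f x * g x).
Proof. intros Hf Hg x; apply (continuous_mult f g); [apply Hf | apply Hg]. Qed.

Lemma cts_pow (f : U -> R) (n : nat) : cts f -> cts (fun x => f x ^ n).
Proof.
  intros Hf; induction n as [|n IH]; simpl.
  - apply cts_const.
  - apply cts_mult; assumption.
Qed.

Lemma cts_sum3 (f : axis -> U -> R) :
  (forall k, cts (f k)) -> cts (fun x => sum3 (fun k => f k x)).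
Proof. intros Hf; unfold sum3; repeat apply cts_plus; apply Hf. Qed.

(* A tube around [{u0} * [a, b]] on which [F] oscillates by less than [eps] exists by compactness of [[a, b]]. *)
Lemma cts_RInt_le (F : U -> R -> R) (a b : R) : a <= b ->
  cts (fun q : U * R => F (fst q) (snd q)) ->
  cts (fun u => RInt (F u) a b).
Proof.
  intros Hab HF u0.
  assert (Hex : forall u, ex_RInt (F u) a b).
  { intros u; apply (ex_RInt_continuous (V := R_CompleteNormedModule)); intros s _.
    apply (continuous_comp_2 (fun _ => u) (fun y : R => y) F);
      [apply continuous_const | apply continuous_id | apply (HF (u, s))]. }
  apply filterlim_locally; intros eps.
  (* The [+ 1] keeps the denominator positive when [a = b]. An oscillation bounded by this number
     changes the integral by at most [(b - a) * eps / (2 * (b - a + 1)) < eps]. *)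
  assert (Hpos : 0 < eps / (2 * (b - a + 1))).
  { apply Rdiv_lt_0_compat; [apply cond_pos | lra]. }
  set (e := mkposreal _ Hpos).
  destruct (functional_choice
    (fun (s : R) (d : posreal) => forall q : U * R, ball (u0, s) d q ->
       ball (F u0 s) (e/2) (F (fst q) (snd q)))) as [delta Hdelta].
  { intros s. destruct (proj1 (filterlim_locally _ _) (HF (u0, s)) (pos_div_2 e)) as [d Hd].
    exists d; exact Hd. }
  destruct (compactness_value_1d a b delta) as [d Hd].
  exists d; intros u Hu.
  assert (Hclose : forall s, a <= s <= b -> Rabs (F u s - F u0 s) <= e).
  (* [compactness_value_1d] yields only the double negation of a covering ball around [s], so the
     bound is obtained by contradiction. Comparing both values with the one at the centre [r] costs
     [e / 2] twice. *)
  { intros s Hs. apply Rnot_lt_le; intros Hlt.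
    apply (Hd s Hs); intros [r [Hr [Hsr Hdr]]].
    assert (H1 := Hdelta r (u, s)). assert (H2 := Hdelta r (u0, s)).
    simpl in H1, H2.
    assert (Hball : ball r (delta r) s) by exact Hsr.
    specialize (H1 (conj (ball_le _ _ _ Hdr _ Hu) Hball)).
    specialize (H2 (conj (ball_center _ _) Hball)).
    change (Rabs (F u s - F u0 r) < e / 2) in H1.
    change (Rabs (F u0 s - F u0 r) < e / 2) in H2.
    apply Rabs_def2 in H1. apply Rabs_def2 in H2.
    apply (Rlt_irrefl e). apply (Rlt_trans _ _ _ Hlt).
    apply Rabs_def1; lra. }
  change (Rabs (RInt (F u) a b - RInt (F u0) a b) < eps).
  assert (Hn := norm_RInt_le_const (fun s => minus (F u s) (F u0 s)) a b _ e Hab Hclose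
     (is_RInt_minus _ _ _ _ _ _ (RInt_correct _ _ _ (Hex u)) (RInt_correct _ _ _ (Hex u0)))).
  change (Rabs (RInt (F u) a b - RInt (F u0) a b) <= (b - a) * e) in Hn.
  apply (Rle_lt_trans _ _ _ Hn).
  simpl. assert (He := cond_pos eps).
  replace ((b - a) * (eps / (2 * (b - a + 1)))) with (eps * ((b - a) / (2 * (b - a + 1)))) by (field; lra).
  rewrite <- (Rmult_1_r eps) at 2. apply Rmult_lt_compat_l; [exact He |].
  apply Rlt_div_l; lra.
Qed.

Lemma cts_RInt (F : U -> R -> R) (a b : R) :
  cts (fun q : U * R => F (fst q) (snd q)) ->
  cts (fun u => RInt (F u) a b).
Proof.
  intros HF; destruct (Rle_dec a b) as [Hab | Hab]; [apply cts_RInt_le; assumption |].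
  intros u; apply (continuous_ext (fun u => - RInt (F u) b a)).
  - intros v; apply (opp_RInt_swap (V := R_CompleteNormedModule)).
    apply (ex_RInt_continuous (V := R_CompleteNormedModule)); intros s _.
    apply (continuous_comp_2 (fun _ => v) (fun y : R => y) F);
      [apply continuous_const | apply continuous_id | apply (HF (v, s))].
  - apply (continuous_opp (fun u => RInt (F u) b a)).
    apply cts_RInt_le; [lra | exact HF].
Qed.
End Cts.

(** Syntax-directed search. The last cases use continuity hypotheses on families indexed by [axis],
    which is why later proofs name the clamped fields by [set] before calling [cts_tac]. *)
Ltac cts_step :=
  match goal with
  | H : ?P |- ?P => exact H
  | |- cts (fun _ => ?c) => apply cts_const
  | |- cts (fun x => x) => apply cts_id
  | |- cts (fun x => (@?f x, @?g x)) => apply (cts_pair f g)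
  | |- cts (fun x => fst (@?f x)) => apply (cts_fst f)
  | |- cts (fun x => snd (@?f x)) => apply (cts_snd f)
  | |- cts (fun x => @?f x + @?g x) => apply (cts_plus f g)
  | |- cts (fun x => @?f x - @?g x) => apply (cts_minus f g)
  | |- cts (fun x => @?f x * @?g x) => apply (cts_mult f g)
  | |- cts (fun x => - @?f x) => apply (cts_opp f)
  | |- cts (fun x => @?f x ^ ?n) => apply (cts_pow f n)
  | |- cts (fun x => sum3 (fun k => @?f k x)) => apply (cts_sum3 (fun k x => f k x)); intros ?
  | |- cts (fun x => RInt (@?F x) ?a ?b) => apply (cts_RInt F)
  | H : cts ?f |- cts (fun x => ?f (@?g x)) => apply (cts_comp f g H)
  | H : forall k : axis, cts (?f k) |- cts (fun x => ?f ?k (@?g x)) => apply (cts_comp (f k) g (H k))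
  | H : forall k : axis, cts (?f k) |- cts (?f ?k) => apply (H k)
  | H : forall j k : axis, cts (?f j k) |- cts (fun x => ?f ?j ?k (@?g x)) => apply (cts_comp (f j k) g (H j k))
  | H : forall j k : axis, cts (?f j k) |- cts (?f ?j ?k) => apply (H j k)
  end.
Ltac cts_tac := cbv beta; repeat (cts_step; cbv beta).

(** * Integrals of continuous functions: parameters, fundamental theorem, exchange of order *)

Lemma cts_ex_RInt (f : R -> R) (a b : R) : cts f -> ex_RInt f a b.
Proof. intros Hf; apply (ex_RInt_continuous (V := R_CompleteNormedModule)); intros z _; apply Hf. Qed.

(** [is_derive_RInt_param] asks for joint continuity of the [Derive] of the integrand; a given
    jointly continuous derivative [df] provides it. *)
Lemma is_derive_RInt_param_cts (f df : R -> R -> R) (a b x : R) :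
  (forall y s, is_derive (fun z => f z s) y (df y s)) ->
  (forall y, cts (f y)) -> cts (fun q : R * R => df (fst q) (snd q)) ->
  is_derive (fun y => RInt (f y) a b) x (RInt (df x) a b).
Proof.
  intros Hd Hf Hdf.
  assert (HD : forall y s, Derive (fun z => f z s) y = df y s).
  { intros y s; apply is_derive_unique, Hd. }
  rewrite (RInt_ext (df x) (fun s => Derive (fun z => f z s) x));
    [| intros s _; symmetry; apply HD].
  apply (is_derive_RInt_param f).
  - apply filter_forall; intros y s _; exists (df y s); apply Hd.
  - intros s _. apply (continuity_2d_pt_ext df); [intros; symmetry; apply HD |].
    apply continuity_2d_pt_filterlim; exact (Hdf (x, s)).
  - apply filter_forall; intros y; apply cts_ex_RInt, Hf.
Qed.

(** [F] minus the primitive of [dF] has zero derivative inside the interval and is continuous up to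
    the ends, so the mean value theorem makes it constant. No derivative at the end points is asked
    for, because the clamped fields need not have one at the walls. *)
Lemma RInt_derive_open (F dF : R -> R) (a b : R) : a <= b ->
  cts F -> cts dF -> (forall x, a < x < b -> is_derive F x (dF x)) ->
  RInt dF a b = F b - F a.
Proof.
  intros Hab HF HdF Hd.
  assert (HI : forall x, is_derive (fun y => RInt dF a y) x (dF x)).
  { intros x; apply (is_derive_RInt dF _ a); [| apply HdF].
    apply filter_forall; intros y; apply (RInt_correct (V := R_CompleteNormedModule)), cts_ex_RInt, HdF. }
  destruct (MVT_gen (fun y => F y - RInt dF a y) a b (fun _ => 0)) as [c [_ Hc]].
  - intros x Hx; rewrite Rmin_left, Rmax_right in Hx by exact Hab.
    replace 0 with (minus (dF x) (dF x)) by apply Rminus_diag.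
    apply (is_derive_minus F (fun y => RInt dF a y)); [apply Hd, Hx | apply HI].
  - intros x _; apply continuity_pt_filterlim.
    apply (continuous_minus F (fun y => RInt dF a y)); [apply HF |].
    apply (ex_derive_continuous (K := R_AbsRing) (V := R_NormedModule)); exists (dF x); apply HI.
  - rewrite RInt_point in Hc; unfold zero in Hc; simpl in Hc. lra.
Qed.

(** With the upper limit [b] replaced by a variable [z], the right-hand side vanishes at [z = a] and
    has derivative [RInt (f z) c d], so integrating this derivative from [a] to [b] gives the
    left-hand side. *)
Lemma RInt_swap (f : R -> R -> R) (a b c d : R) : a <= b ->
  cts (fun q : R * R => f (fst q) (snd q)) ->
  RInt (fun x => RInt (fun y => f x y) c d) a b
  = RInt (fun y => RInt (fun x => f x y) a b) c d.
Proof.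
  intros Hab Hf.
  assert (Hf' : cts (fun q : R * R => f (snd q) (fst q))).
  { apply (cts_comp (fun q : R * R => f (fst q) (snd q)) (fun q : R * R => (snd q, fst q)) Hf); cts_tac. }
  assert (Hy : forall y, cts (fun x => f x y)).
  { intros y; apply (cts_comp (fun q : R * R => f (fst q) (snd q)) (fun x => (x, y)) Hf); cts_tac. }
  assert (HF : forall z, is_derive (fun z => RInt (fun y => RInt (fun x => f x y) a z) c d) z
                           (RInt (f z) c d)).
  { intros z; apply (is_derive_RInt_param_cts (fun z y => RInt (fun x => f x y) a z) f).
    - intros x y; apply (is_derive_RInt (fun x => f x y) _ a); [| apply Hy].
      apply filter_forall; intros w.
      apply (RInt_correct (V := R_CompleteNormedModule)), cts_ex_RInt, Hy.
    - intros w; apply (cts_RInt (fun y x => f x y)), Hf'.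
    - exact Hf. }
  rewrite (RInt_derive_open (fun z => RInt (fun y => RInt (fun x => f x y) a z) c d)
    (fun x => RInt (fun y => f x y) c d) a b Hab).
  - rewrite (RInt_ext (fun y => RInt (fun x => f x y) a a) (fun _ => 0)).
    + rewrite (RInt_const (V := R_CompleteNormedModule)).
      unfold scal; simpl; unfold mult; simpl; ring.
    + intros y _; apply (RInt_point (V := R_CompleteNormedModule)).
  - intros z; apply (ex_derive_continuous (K := R_AbsRing) (V := R_NormedModule)).
    eexists; apply HF.
  - apply cts_RInt, Hf.
  - intros z _; apply HF.
Qed.

(** * Clamping the height to the slab *)

Definition clamp (h y : R) : R := Rmax 0 (Rmin h y).

Lemma clamp_bounds (h y : R) : 0 < h -> 0 <= clamp h y <= h.
Proof. intros Hh; unfold clamp, Rmax, Rmin; repeat destruct Rle_dec; lra. Qed.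

Lemma clamp_id (h y : R) : 0 <= y <= h -> clamp h y = y.
Proof. intros Hy; unfold clamp, Rmax, Rmin; repeat destruct Rle_dec; lra. Qed.

Lemma cts_clamp (h : R) : cts (clamp h).
Proof.
  intros x; apply filterlim_locally; intros eps; exists eps; intros y Hy.
  change (Rabs (y - x) < eps) in Hy; change (Rabs (clamp h y - clamp h x) < eps).
  apply Rabs_def2 in Hy; apply Rabs_def1;
    unfold clamp, Rmax, Rmin; repeat destruct Rle_dec; lra.
Qed.

Definition slab_proj (h : R) (p : spacetime) : spacetime :=
  (fst (fst p), clamp h (snd (fst p)), snd p).

Lemma slab_slab_proj (h : R) (p : spacetime) : 0 < h -> slab h (slab_proj h p).
Proof. intros Hh; destruct p as [[[x1 x2] x3] t]; apply clamp_bounds, Hh. Qed.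

Lemma slab_proj_id (h : R) (p : spacetime) : slab h p -> slab_proj h p = p.
Proof.
  destruct p as [[[x1 x2] x3] t]; simpl; intros Hp.
  unfold slab_proj; simpl; rewrite clamp_id by exact Hp; reflexivity.
Qed.

(** [continuous_on] gives limits along points of the slab only. The projection always lands in the
    slab, so after composing with it the restriction is met automatically. *)
Lemma cts_slab_proj (h : R) (f : spacetime -> R) : 0 < h ->
  continuous_on (slab h) f -> cts (fun p => f (slab_proj h p)).
Proof.
  intros Hh Hf p.
  assert (Hc : cts (slab_proj h)).
  { unfold slab_proj; assert (Hcl := cts_clamp h); cts_tac. }
  apply (filterlim_comp _ _ _ (slab_proj h) f (locally p)
           (within (slab h) (locally (slab_proj h p)))).
  - intros S HS; change (locally p (fun q => S (slab_proj h q))).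
    apply (filter_imp (fun q => slab h (slab_proj h q) -> S (slab_proj h q)));
      [| exact (Hc p _ HS)].
    intros q Hq; apply Hq, slab_slab_proj, Hh.
  - apply Hf, slab_slab_proj, Hh.
Qed.

(** * Axis-parallel lines and derivatives relative to the slab *)

Definition coord_of (c : coord) (p : spacetime) : R :=
  let '(x1, x2, x3, t) := p in
  match c with
  | Space X1 => x1
  | Space X2 => x2
  | Space X3 => x3
  | Time => t
  end.

(** Parametrizes the line through [p] in direction [c], so that partial derivatives become
    [is_derive] statements about functions of one real variable. *)
Definition set_coord (c : coord) (p : spacetime) (y : R) : spacetime :=
  let '(x1, x2, x3, t) := p in
  match c with
  | Space X1 => (y, x2, x3, t)
  | Space X2 => (x1, y, x3, t)
  | Space X3 => (x1, x2, y, t)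
  | Time => (x1, x2, x3, y)
  end.

Lemma shift_set_coord (c : coord) (s : R) (p : spacetime) :
  shift c s p = set_coord c p (coord_of c p + s).
Proof. destruct p as [[[x1 x2] x3] t]; destruct c as [[] |]; reflexivity. Qed.

Lemma set_coord_of (c : coord) (p : spacetime) : set_coord c p (coord_of c p) = p.
Proof. destruct p as [[[x1 x2] x3] t]; destruct c as [[] |]; reflexivity. Qed.

(* Points of the slab at which [is_partial h c] is an ordinary two-sided derivative. *)
Definition two_sided (h : R) (c : coord) (p : spacetime) : Prop :=
  slab h p /\ (c = Space X3 -> 0 < coord_of X3 p < h).

Lemma shift_in_slab (h : R) (c : coord) (p : spacetime) : two_sided h c p ->
  locally 0 (fun s => slab h (shift c s p)).
Proof.
  destruct p as [[[x1 x2] x3] t]; intros [Hp Hc]; simpl in Hp.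
  destruct c as [[] |]; try (apply filter_forall; intros s; exact Hp).
  specialize (Hc eq_refl); simpl in Hc.
  assert (Hpos : 0 < Rmin x3 (h - x3)) by (apply Rmin_pos; lra).
  exists (mkposreal _ Hpos); intros s Hs.
  change (Rabs (s - 0) < Rmin x3 (h - x3)) in Hs; simpl.
  assert (H1 := Rmin_l x3 (h - x3)); assert (H2 := Rmin_r x3 (h - x3)).
  apply Rabs_def2 in Hs; lra.
Qed.

(** At a two-sided point all small increments stay in the slab, so the filter of [is_partial] is
    that of the ordinary difference quotient. *)
Lemma is_partial_is_derive (h : R) (c : coord) (f : spacetime -> R) (p : spacetime) (l : R) :
  two_sided h c p -> is_partial h c f p l ->
  is_derive (fun y => f (set_coord c p y)) (coord_of c p) l.
Proof.
  intros Hp Hf; apply is_derive_Reals; intros eps Heps.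
  assert (H1 := shift_in_slab h c p Hp).
  assert (H2 := proj1 (filterlim_locally _ _) Hf (mkposreal eps Heps)).
  destruct (filter_and _ _ H1 H2) as [d Hd].
  exists d; intros s Hs0 Hs.
  assert (Hball : ball 0 d s).
  { change (Rabs (s - 0) < d); rewrite Rminus_0_r; exact Hs. }
  destruct (Hd s Hball) as [H3 H4].
  specialize (H4 (conj Hs0 H3)).
  rewrite shift_set_coord in H4; rewrite set_coord_of; exact H4.
Qed.

(** Uniqueness of the limit, and with it the correctness of [iota], requires admissible increments
    of arbitrarily small size; they exist even at the walls since [h > 0]. *)
Lemma proper_partial_filter (h : R) (c : coord) (p : spacetime) : 0 < h -> slab h p ->
  ProperFilter' (within (fun s : R => s <> 0 /\ slab h (shift c s p)) (locally 0)).
Proof.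
  intros Hh Hp; constructor; [| apply within_filter, locally_filter].
  intros [d Hd].
  assert (Hex : exists s, Rabs s < d /\ s <> 0 /\ slab h (shift c s p)).
  { assert (Hd0 := cond_pos d).
    assert (H0 : 0 < Rmin (d / 2) (h / 2)) by (apply Rmin_pos; lra).
    assert (H1 := Rmin_l (d / 2) (h / 2)); assert (H2 := Rmin_r (d / 2) (h / 2)).
    destruct p as [[[x1 x2] x3] t]; simpl in Hp.
    (* In the lower half of the slab the step goes up, in the upper half down; a length of at most
       [h / 2] cannot leave the slab. *)
    destruct (Rle_dec x3 (h / 2)) as [Hx | Hx];
      [exists (Rmin (d / 2) (h / 2)) | exists (- Rmin (d / 2) (h / 2))];
      (split; [apply Rabs_def1; lra | split; [lra | destruct c as [[] |]; simpl; lra]]). }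
  destruct Hex as [s [H1 H2]].
  apply (Hd s); [| exact H2].
  change (Rabs (s - 0) < d); rewrite Rminus_0_r; exact H1.
Qed.

Lemma partial_deriv_eq (h : R) (c : coord) (f : spacetime -> R) (p : spacetime) (l : R) :
  0 < h -> slab h p -> is_partial h c f p l -> partial_deriv h c f p = l.
Proof.
  intros Hh Hp Hl.
  assert (Hu : forall l', is_partial h c f p l' -> l = l').
  { intros l' Hl'.
    exact (filterlim_locally_unique (K := R_AbsRing) (V := R_NormedModule)
      (FF := proper_partial_filter h c p Hh Hp) _ _ _ Hl Hl'). }
  symmetry; apply Hu.
  apply (iota_correct (V := R_CompleteNormedModule) (is_partial h c f p)).
  exists l; split; assumption.
Qed.

Lemma partial_deriv_correct (h : R) (c : coord) (f : spacetime -> R) (p : spacetime) :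
  0 < h -> slab h p -> ex_partial h c f p -> is_partial h c f p (partial_deriv h c f p).
Proof.
  intros Hh Hp [l Hl]; rewrite (partial_deriv_eq h c f p l Hh Hp Hl); exact Hl.
Qed.

Lemma is_partial_minus (h : R) (c : coord) (f g : spacetime -> R) (p : spacetime) (l m : R) :
  is_partial h c f p l -> is_partial h c g p m ->
  is_partial h c (fun q => f q - g q) p (l - m).
Proof.
  intros Hf Hg; unfold is_partial in *.
  apply filterlim_ext with (fun s => plus ((f (shift c s p) - f p) / s) (opp ((g (shift c s p) - g p) / s))).
  - intros s.
    change ((f (shift c s p) - f p) / s + - ((g (shift c s p) - g p) / s)
      = (f (shift c s p) - g (shift c s p) - (f p - g p)) / s).
    unfold Rdiv; ring.
  - eapply filterlim_comp_2; [exact Hf | | apply (filterlim_plus (V := R_NormedModule))].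
    eapply filterlim_comp; [exact Hg | apply (filterlim_opp (V := R_NormedModule))].
Qed.

(** * Horizontal translations, and continuity along the vertical *)

Lemma shift_comm (c d : coord) (s r : R) (p : spacetime) :
  shift c s (shift d r p) = shift d r (shift c s p).
Proof.
  destruct p as [[[x1 x2] x3] t]; destruct c as [[] |]; destruct d as [[] |]; simpl;
    rewrite ?Rplus_assoc, ?(Rplus_comm r s); reflexivity.
Qed.

Lemma slab_shift (h L : R) (i : axis) (p : spacetime) : i <> X3 ->
  slab h (shift i L p) <-> slab h p.
Proof. destruct p as [[[x1 x2] x3] t]; destruct i; simpl; tauto. Qed.

(** A horizontal translation commutes with every shift and preserves the slab, so both sides are
    limits of the same quotients over the same increments. *)
Lemma is_partial_shift (h L : R) (i : axis) (c : coord) (f : spacetime -> R) (p : spacetime) (l : R) :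
  i <> X3 -> is_partial h c f (shift i L p) l <-> is_partial h c (fun q => f (shift i L q)) p l.
Proof.
  intros Hi; unfold is_partial.
  split; intros H S HS; specialize (H S HS); unfold filtermap, within in *;
    revert H; apply filter_imp;
    intros s Hs [Hs0 Hsl]; [rewrite <- shift_comm | rewrite shift_comm]; apply Hs; (split; [exact Hs0 |]).
  - rewrite shift_comm; apply slab_shift; assumption.
  - rewrite shift_comm, slab_shift in Hsl; assumption.
Qed.

Lemma is_partial_ext (h : R) (c : coord) (f g : spacetime -> R) (p : spacetime) (l : R) :
  slab h p -> (forall q, slab h q -> f q = g q) -> is_partial h c f p l -> is_partial h c g p l.
Proof.
  intros Hp Hfg; apply filterlim_within_ext; intros s [_ Hs].
  rewrite !Hfg by assumption; reflexivity.
Qed.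

Lemma partial_deriv_periodic (h L : R) (i : axis) (c : coord) (f : spacetime -> R) :
  0 < h -> i <> X3 -> (forall p, slab h p -> ex_partial h c f p) ->
  periodic h i L f -> periodic h i L (partial_deriv h c f).
Proof.
  intros Hh Hi Hex Hper p Hp.
  apply partial_deriv_eq; [exact Hh | apply slab_shift; assumption |].
  apply is_partial_shift; [exact Hi |].
  apply is_partial_ext with f; [exact Hp | intros q Hq; symmetry; apply Hper, Hq |].
  apply partial_deriv_correct; auto.
Qed.

(** Differentiability implies continuity, also in the one-sided sense at the walls. It is meant for
    the pressure, which is only assumed to have a gradient. *)
Lemma ex_partial_cts_x3 (h : R) (f : spacetime -> R) (x1 x2 t : R) : 0 < h ->
  (forall x3, 0 <= x3 <= h -> ex_partial h X3 f (x1, x2, x3, t)) ->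
  cts (fun x3 => f (x1, x2, clamp h x3, t)).
Proof.
  intros Hh Hex y.
  set (x3 := clamp h y). assert (Hx3 : 0 <= x3 <= h) by (apply clamp_bounds, Hh).
  destruct (Hex x3 Hx3) as [l Hl].
  apply filterlim_locally; intros eps.
  destruct (proj1 (filterlim_locally _ _) Hl (mkposreal 1 Rlt_0_1)) as [d Hd].
  assert (HM : 0 < Rabs l + 1) by (assert (H := Rabs_pos l); lra).
  (* Within distance [d] the difference quotient is smaller than [Rabs l + 1] in absolute value, so
     the second entry makes the increment of [f] smaller than [eps]. *)
  assert (Hpos : 0 < Rmin d (eps / (Rabs l + 1))).
  { apply Rmin_pos; [apply cond_pos | apply Rdiv_lt_0_compat; [apply cond_pos | exact HM]]. }
  apply (filter_imp (fun z => ball x3 (mkposreal _ Hpos) (clamp h z)));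
    [| exact (cts_clamp h y _ (locally_ball _ (mkposreal _ Hpos)))].
  intros z Hz; change (Rabs (clamp h z - x3) < Rmin d (eps / (Rabs l + 1))) in Hz.
  change (Rabs (f (x1, x2, clamp h z, t) - f (x1, x2, x3, t)) < eps).
  set (s := clamp h z - x3) in *.
  (* The zero increment is excluded from the difference quotient. It does occur here, since clamping
     can send different heights to the same wall. *)
  destruct (Req_dec s 0) as [H0 | H0].
  { replace (clamp h z) with x3 by (unfold s in H0; lra).
    rewrite Rminus_diag, Rabs_R0; apply cond_pos. }
  assert (Hs : shift X3 s (x1, x2, x3, t) = (x1, x2, clamp h z, t)).
  { unfold s; simpl; do 2 f_equal; ring. }
  assert (Hsd : ball 0 d s).
  { change (Rabs (s - 0) < d); rewrite Rminus_0_r.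
    apply (Rlt_le_trans _ _ _ Hz), Rmin_l. }
  assert (Hb := Hd s Hsd); rewrite Hs in Hb.
  specialize (Hb (conj H0 (clamp_bounds h z Hh))).
  change (Rabs ((f (x1, x2, clamp h z, t) - f (x1, x2, x3, t)) / s - l) < 1) in Hb.
  set (D := f (x1, x2, clamp h z, t) - f (x1, x2, x3, t)) in *.
  assert (HD : Rabs (D / s) < Rabs l + 1).
  { replace (D / s) with ((D / s - l) + l) by ring.
    apply (Rle_lt_trans _ _ _ (Rabs_triang _ _)); lra. }
  replace D with ((D / s) * s) by (field; exact H0).
  rewrite Rabs_mult.
  apply Rlt_le_trans with ((Rabs l + 1) * (eps / (Rabs l + 1))).
  - apply Rmult_le_0_lt_compat; try apply Rabs_pos; [exact HD |].
    apply (Rlt_le_trans _ _ _ Hz), Rmin_r.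
  - right; field; lra.
Qed.

(** * The integral over the box *)

Lemma int_box_ext (Pi1 Pi2 h : R) (f g : spacetime -> R) (t : R) : 0 < h ->
  (forall x1 x2 x3, 0 <= x3 <= h -> f (x1, x2, x3, t) = g (x1, x2, x3, t)) ->
  int_box Pi1 Pi2 h f t = int_box Pi1 Pi2 h g t.
Proof.
  intros Hh Hfg; unfold int_box.
  apply RInt_ext; intros x1 _; apply RInt_ext; intros x2 _; apply RInt_ext; intros x3 Hx3.
  rewrite Rmin_left, Rmax_right in Hx3 by lra; apply Hfg; lra.
Qed.

Lemma int_box_plus (Pi1 Pi2 h : R) (f g : spacetime -> R) (t : R) : cts f -> cts g ->
  int_box Pi1 Pi2 h (fun p => f p + g p) t = int_box Pi1 Pi2 h f t + int_box Pi1 Pi2 h g t.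
Proof.
  intros Hf Hg; unfold int_box.
  rewrite <- (RInt_plus (V := R_CompleteNormedModule)) by (apply cts_ex_RInt; cts_tac).
  apply RInt_ext; intros x1 _.
  etransitivity; [| apply (RInt_plus (V := R_CompleteNormedModule)); apply cts_ex_RInt; cts_tac].
  apply RInt_ext; intros x2 _.
  apply (RInt_plus (V := R_CompleteNormedModule)); apply cts_ex_RInt; cts_tac.
Qed.

Lemma int_box_scal (Pi1 Pi2 h c : R) (f : spacetime -> R) (t : R) : cts f ->
  int_box Pi1 Pi2 h (fun p => c * f p) t = c * int_box Pi1 Pi2 h f t.
Proof.
  intros Hf; unfold int_box.
  etransitivity; [| apply (RInt_scal (V := R_CompleteNormedModule)); apply cts_ex_RInt; cts_tac].
  apply RInt_ext; intros x1 _.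
  etransitivity; [| apply (RInt_scal (V := R_CompleteNormedModule)); apply cts_ex_RInt; cts_tac].
  apply RInt_ext; intros x2 _.
  apply (RInt_scal (V := R_CompleteNormedModule)); apply cts_ex_RInt; cts_tac.
Qed.

Lemma int_box_ge0 (Pi1 Pi2 h : R) (f : spacetime -> R) (t : R) :
  0 < Pi1 -> 0 < Pi2 -> 0 < h -> cts f -> (forall p, 0 <= f p) ->
  0 <= int_box Pi1 Pi2 h f t.
Proof.
  intros H1 H2 Hh Hf H0; unfold int_box.
  apply RInt_ge_0; [lra | apply cts_ex_RInt; cts_tac | intros x1 _].
  apply RInt_ge_0; [lra | apply cts_ex_RInt; cts_tac | intros x2 _].
  apply RInt_ge_0; [lra | apply cts_ex_RInt; cts_tac | intros x3 _; apply H0].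
Qed.

Lemma is_derive_int_box (Pi1 Pi2 h : R) (f df : spacetime -> R) (t : R) : cts f -> cts df ->
  (forall p, is_derive (fun s => f (set_coord Time p s)) (coord_of Time p) (df p)) ->
  is_derive (int_box Pi1 Pi2 h f) t (int_box Pi1 Pi2 h df t).
Proof.
  intros Hf Hdf Hd.
  assert (H3 : forall x1 x2 s, is_derive (fun s => RInt (fun x3 => f (x1, x2, x3, s)) 0 h) s
            (RInt (fun x3 => df (x1, x2, x3, s)) 0 h)).
  { intros x1 x2 s.
    apply (is_derive_RInt_param_cts (fun s x3 => f (x1, x2, x3, s)) (fun s x3 => df (x1, x2, x3, s)));
      [intros r x3; apply (Hd (x1, x2, x3, r)) | intros r; cts_tac | cts_tac]. }
  assert (H2 : forall x1 s, is_derive (fun s => RInt (fun x2 => RInt (fun x3 => f (x1, x2, x3, s)) 0 h) 0 Pi2) s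
            (RInt (fun x2 => RInt (fun x3 => df (x1, x2, x3, s)) 0 h) 0 Pi2)).
  { intros x1 s.
    apply (is_derive_RInt_param_cts (fun s x2 => RInt (fun x3 => f (x1, x2, x3, s)) 0 h)
      (fun s x2 => RInt (fun x3 => df (x1, x2, x3, s)) 0 h));
      [intros r x2; apply H3 | intros r; cts_tac | cts_tac]. }
  apply (is_derive_RInt_param_cts (fun s x1 => RInt (fun x2 => RInt (fun x3 => f (x1, x2, x3, s)) 0 h) 0 Pi2)
      (fun s x1 => RInt (fun x2 => RInt (fun x3 => df (x1, x2, x3, s)) 0 h) 0 Pi2));
      [intros r x1; apply H2 | intros r; cts_tac | cts_tac].
Qed.

(** * Integrals of derivatives over the box vanish *)

Section Divergence.
Variables (Pi1 Pi2 h : R) (A dA : spacetime -> R) (t : R).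
Hypotheses (hPi1 : 0 < Pi1) (hPi2 : 0 < Pi2) (hh : 0 < h) (HA : cts A) (HdA : cts dA).

(** The outermost variable is the one differentiated, so the derivative is first taken outside the
    two inner integrals. *)
Lemma int_box_d1 :
  (forall x1 x2 x3, is_derive (fun y => A (y, x2, x3, t)) x1 (dA (x1, x2, x3, t))) ->
  (forall x2 x3, A (Pi1, x2, x3, t) = A (0, x2, x3, t)) ->
  int_box Pi1 Pi2 h dA t = 0.
Proof.
  intros Hd Hper.
  set (G x1 := RInt (fun x2 => RInt (fun x3 => A (x1, x2, x3, t)) 0 h) 0 Pi2).
  transitivity (G Pi1 - G 0).
  - apply RInt_derive_open; [lra | unfold G; cts_tac | cts_tac |].
    intros x1 _.
    apply (is_derive_RInt_param_cts (fun x1 x2 => RInt (fun x3 => A (x1, x2, x3, t)) 0 h)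
      (fun x1 x2 => RInt (fun x3 => dA (x1, x2, x3, t)) 0 h)); [| intros; cts_tac | cts_tac].
    intros y x2.
    apply (is_derive_RInt_param_cts (fun x1 x3 => A (x1, x2, x3, t))
      (fun x1 x3 => dA (x1, x2, x3, t))); [| intros; cts_tac | cts_tac].
    intros; apply Hd.
  - apply Rminus_diag_eq; unfold G.
    apply RInt_ext; intros x2 _; apply RInt_ext; intros x3 _; apply Hper.
Qed.

Lemma int_box_d2 :
  (forall x1 x2 x3, is_derive (fun y => A (x1, y, x3, t)) x2 (dA (x1, x2, x3, t))) ->
  (forall x1 x3, A (x1, Pi2, x3, t) = A (x1, 0, x3, t)) ->
  int_box Pi1 Pi2 h dA t = 0.
Proof.
  intros Hd Hper; unfold int_box.
  rewrite (RInt_ext _ (fun _ => 0)).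
  - rewrite (RInt_const (V := R_CompleteNormedModule)); apply Rmult_0_r.
  - intros x1 _; set (G x2 := RInt (fun x3 => A (x1, x2, x3, t)) 0 h).
    transitivity (G Pi2 - G 0).
    + apply RInt_derive_open; [lra | unfold G; cts_tac | cts_tac |].
      intros x2 _.
      apply (is_derive_RInt_param_cts (fun x2 x3 => A (x1, x2, x3, t))
        (fun x2 x3 => dA (x1, x2, x3, t))); [| intros; cts_tac | cts_tac].
      intros; apply Hd.
    + apply Rminus_diag_eq; unfold G; apply RInt_ext; intros x3 _; apply Hper.
Qed.

(** The innermost integral already vanishes. The derivative is asked for strictly between the walls
    only, where the clamped fields are differentiable in [x3]. *)
Lemma int_box_d3 :
  (forall x1 x2 x3, 0 < x3 < h -> is_derive (fun y => A (x1, x2, y, t)) x3 (dA (x1, x2, x3, t))) ->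
  (forall x1 x2, A (x1, x2, h, t) = A (x1, x2, 0, t)) ->
  int_box Pi1 Pi2 h dA t = 0.
Proof.
  intros Hd Hbd; unfold int_box.
  rewrite (RInt_ext _ (fun _ => 0)).
  - rewrite (RInt_const (V := R_CompleteNormedModule)); apply Rmult_0_r.
  - intros x1 _; rewrite (RInt_ext _ (fun _ => 0)).
    + rewrite (RInt_const (V := R_CompleteNormedModule)); apply Rmult_0_r.
    + intros x2 _; transitivity (A (x1, x2, h, t) - A (x1, x2, 0, t)).
      * apply (RInt_derive_open (fun x3 => A (x1, x2, x3, t))); [lra | cts_tac | cts_tac |].
        intros; apply Hd; assumption.
      * apply Rminus_diag_eq, Hbd.
Qed.
End Divergence.

(** * Functions recovered from their spatial gradient *)

(** The fundamental theorem along [r => F (x * r)]. On the fixed interval from 0 to 1 the dependence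
    on [x] sits in the integrand, where [cts_RInt] can handle it. *)
Lemma is_derive_line_integral (F dF : R -> R) (x : R) : cts dF ->
  (forall y, is_derive F y (dF y)) -> F x = F 0 + x * RInt (fun r => dF (x * r)) 0 1.
Proof.
  intros HdF Hd.
  assert (HF : cts F).
  { intros z; apply (ex_derive_continuous (K := R_AbsRing) (V := R_NormedModule)).
    eexists; apply Hd. }
  assert (Hc : cts (fun r => dF (x * r))) by cts_tac.
  assert (H := RInt_derive_open (fun r => F (x * r)) (fun r => x * dF (x * r)) 0 1 Rle_0_1).
  rewrite (RInt_scal (V := R_CompleteNormedModule) (fun r => dF (x * r))) in H
    by (apply cts_ex_RInt, Hc).
  rewrite Rmult_1_r, Rmult_0_r in H.
  change (scal x (RInt (fun r => dF (x * r)) 0 1)) with (x * RInt (fun r => dF (x * r)) 0 1) in H.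
  rewrite H; [ring | cts_tac | cts_tac |].
  intros r _; apply (is_derive_comp F (fun r => x * r)); [apply Hd |].
  auto_derive; [exact I | ring].
Qed.

Section SpatialGradient.
Variables (h t : R) (f : spacetime -> R) (g : axis -> spacetime -> R).
Hypothesis hh : 0 < h.
Hypothesis Hg : forall k, cts (fun p => g k (slab_proj h p)).
Hypothesis Hf : forall (k : axis) p, slab h p -> is_partial h k f p (g k p).

(** Integrates the gradient from the vertical axis along [x2] and then along [x1]. Both legs are
    horizontal, so all derivatives on them are two-sided, even at the walls. *)
Lemma path_representation (x1 x2 x3 : R) : 0 <= x3 <= h ->
  f (x1, x2, x3, t) = f (0, 0, x3, t)
    + x2 * RInt (fun r => g X2 (0, x2 * r, x3, t)) 0 1
    + x1 * RInt (fun r => g X1 (x1 * r, x2, x3, t)) 0 1.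
Proof.
  intros Hx3.
  assert (Hid : forall y z, slab_proj h (y, z, x3, t) = (y, z, x3, t)).
  { intros y z; apply slab_proj_id; exact Hx3. }
  assert (H2 : cts (fun y => g X2 (0, y, x3, t))).
  { intros y; apply (continuous_ext (fun y => g X2 (slab_proj h (0, y, x3, t))));
      [intros z; rewrite Hid; reflexivity |].
    revert y; apply (cts_comp _ (fun y => (0, y, x3, t)) (Hg X2)); cts_tac. }
  assert (H1 : cts (fun y => g X1 (y, x2, x3, t))).
  { intros y; apply (continuous_ext (fun y => g X1 (slab_proj h (y, x2, x3, t))));
      [intros z; rewrite Hid; reflexivity |].
    revert y; apply (cts_comp _ (fun y => (y, x2, x3, t)) (Hg X1)); cts_tac. }
  rewrite (is_derive_line_integral (fun y => f (y, x2, x3, t)) _ x1 H1).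
  - f_equal; apply (is_derive_line_integral (fun y => f (0, y, x3, t)) _ x2 H2).
    intros y; apply (is_partial_is_derive h X2 f (0, y, x3, t));
      [split; [exact Hx3 | discriminate] | apply Hf; exact Hx3].
  - intros y; apply (is_partial_is_derive h X1 f (y, x2, x3, t));
      [split; [exact Hx3 | discriminate] | apply Hf; exact Hx3].
Qed.

(** Existence of partial derivatives alone does not give joint continuity. In the path
    representation each summand is visibly continuous: the value on the axis by [ex_partial_cts_x3],
    the line integrals by continuity of the gradient. *)
Lemma cts_of_gradient : cts (fun p : spacetime => f (fst (fst p), clamp h (snd (fst p)), t)).
Proof.
  assert (H3 : cts (fun x3 => f (0, 0, clamp h x3, t))).
  { apply ex_partial_cts_x3; [exact hh |]; intros x3 Hx3; eexists; apply Hf; exact Hx3. }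
  set (G k p := g k (slab_proj h p)). assert (HG : forall k, cts (G k)) by exact Hg.
  assert (Hrep : cts (fun p : spacetime => f (0, 0, clamp h (snd (fst p)), t)
    + snd (fst (fst p)) * RInt (fun r => G X2 (0, snd (fst (fst p)) * r, snd (fst p), t)) 0 1
    + fst (fst (fst p)) * RInt (fun r => G X1 (fst (fst (fst p)) * r, snd (fst (fst p)), snd (fst p), t)) 0 1)).
  { cts_tac.
    apply (cts_comp (fun x3 => f (0, 0, clamp h x3, t)) (fun p : spacetime => snd (fst p)) H3); cts_tac. }
  intros p; refine (continuous_ext _ _ _ _ (Hrep p)).
  intros [[[x1 x2] x3] s]; simpl; symmetry; apply path_representation, clamp_bounds, hh.
Qed.

Lemma const_of_gradient0 (x1 x2 x3 : R) : 0 <= x3 <= h ->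
  (forall k p, slab h p -> g k p = 0) -> f (x1, x2, x3, t) = f (0, 0, 0, t).
Proof.
  intros Hx3 H0.
  assert (HR : forall k (q : R -> spacetime), (forall r, slab h (q r)) ->
    RInt (fun r => g k (q r)) 0 1 = 0).
  { intros k q Hq; rewrite (RInt_ext _ (fun _ => 0)).
    - rewrite (RInt_const (V := R_CompleteNormedModule)); apply Rmult_0_r.
    - intros r _; apply H0, Hq. }
  rewrite path_representation, !HR by (try (intros; exact Hx3); exact Hx3).
  (* The vertical leg remains. It is treated with the clamped function, which is continuous
     everywhere and has derivative 0 strictly between the walls. *)
  assert (H := RInt_derive_open (fun y => f (0, 0, clamp h y, t)) (fun _ => 0) 0 x3).
  rewrite (RInt_const (V := R_CompleteNormedModule)) in H.
  rewrite !(clamp_id h) in H by lra.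
  change (scal (x3 - 0) 0) with ((x3 - 0) * 0) in H.
  enough ((x3 - 0) * 0 = f (0, 0, x3, t) - f (0, 0, 0, t)) by lra.
  apply H; [lra | | apply cts_const |].
  - apply ex_partial_cts_x3; [exact hh |]; intros y Hy; eexists; apply Hf; exact Hy.
  - intros y Hy.
    apply (is_derive_ext_loc (fun y => f (0, 0, y, t))).
    + apply (filter_imp (fun z => 0 < z < h)); [intros z Hz; rewrite clamp_id by lra; reflexivity |].
      apply (open_and _ _ (open_gt 0) (open_lt h)); lra.
    + assert (Hs : slab h (0, 0, y, t)) by (simpl; lra).
      assert (HD : two_sided h X3 (0, 0, y, t)) by (split; [exact Hs | intros _; simpl; lra]).
      assert (Hd := is_partial_is_derive h X3 f _ _ HD (Hf X3 _ Hs)).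
      rewrite H0 in Hd by exact Hs; exact Hd.
Qed.
End SpatialGradient.

(** * Directional averages and the Young inequality *)

(** The [x1]-integral is moved to the innermost place by two exchanges, past [x2] and then past
    [x3]. *)
Lemma int_box_avg1 (Pi1 Pi2 h : R) (f : spacetime -> R) (t : R) :
  0 < Pi1 -> 0 < Pi2 -> cts f ->
  int_box Pi1 Pi2 h f t = Pi1 * RInt (fun x2 => RInt (fun x3 => avg1 Pi1 f x2 x3 t) 0 h) 0 Pi2.
Proof.
  intros H1 H2 Hf; unfold int_box, avg1.
  rewrite (RInt_swap (fun x1 x2 => RInt (fun x3 => f (x1, x2, x3, t)) 0 h));
    [| lra | cts_tac].
  etransitivity; [| apply (RInt_scal (V := R_CompleteNormedModule)); apply cts_ex_RInt; cts_tac].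
  apply RInt_ext; intros x2 _.
  rewrite (RInt_swap (fun x1 x3 => f (x1, x2, x3, t))); [| lra | cts_tac].
  etransitivity; [| apply (RInt_scal (V := R_CompleteNormedModule)); apply cts_ex_RInt; cts_tac].
  apply RInt_ext; intros x3 _.
  rewrite <- Rmult_assoc, Rinv_r, Rmult_1_l by lra; reflexivity.
Qed.

Lemma int_box_avg2 (Pi1 Pi2 h : R) (f : spacetime -> R) (t : R) :
  0 < Pi2 -> cts f ->
  int_box Pi1 Pi2 h f t = Pi2 * RInt (fun x1 => RInt (fun x3 => avg2 Pi2 f x1 x3 t) 0 h) 0 Pi1.
Proof.
  intros H2 Hf; unfold int_box, avg2.
  etransitivity; [| apply (RInt_scal (V := R_CompleteNormedModule)); apply cts_ex_RInt; cts_tac].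
  apply RInt_ext; intros x1 _.
  rewrite (RInt_swap (fun x2 x3 => f (x1, x2, x3, t))); [| lra | cts_tac].
  etransitivity; [| apply (RInt_scal (V := R_CompleteNormedModule)); apply cts_ex_RInt; cts_tac].
  apply RInt_ext; intros x3 _.
  rewrite <- Rmult_assoc, Rinv_r, Rmult_1_l by lra; reflexivity.
Qed.

(** Pointwise, [2 |p| |z| <= 2 s^2 |z| <= s^3 + s z^2], the last step being [0 <= s (s - |z|)^2].
    Integration over a rectangle of area [L * h] gives the claim. *)
Lemma RInt_young (a : R -> R -> R) (p s L h : R) :
  0 <= L -> 0 <= h -> 0 <= s -> Rabs p <= s ^ 2 ->
  cts (fun q : R * R => a (fst q) (snd q)) ->
  - (2 * p) * RInt (fun x => RInt (fun y => a x y) 0 h) 0 L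
  <= s ^ 3 * L * h + s * RInt (fun x => RInt (fun y => a x y ^ 2) 0 h) 0 L.
Proof.
  intros HL Hh Hs Hp Ha.
  set (a' := fun q : R * R => a (fst q) (snd q)) in Ha.
  assert (H1 : - (2 * p) * RInt (fun x => RInt (fun y => a x y) 0 h) 0 L
    = RInt (fun x => RInt (fun y => - (2 * p) * a' (x, y)) 0 h) 0 L).
  { symmetry; etransitivity; [| apply (RInt_scal (V := R_CompleteNormedModule));
      apply cts_ex_RInt; apply (cts_RInt (fun x y => a' (x, y))); cts_tac].
    apply RInt_ext; intros x _.
    apply (RInt_scal (V := R_CompleteNormedModule)); apply cts_ex_RInt.
    apply (cts_comp a' (fun y => (x, y)) Ha); cts_tac. }
  assert (H2 : s ^ 3 * L * h + s * RInt (fun x => RInt (fun y => a x y ^ 2) 0 h) 0 L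
    = RInt (fun x => RInt (fun y => s ^ 3 + s * a' (x, y) ^ 2) 0 h) 0 L).
  { symmetry.
    transitivity (RInt (fun x => plus (RInt (fun y => s ^ 3) 0 h) (scal s (RInt (fun y => a' (x, y) ^ 2) 0 h))) 0 L).
    - apply RInt_ext; intros x _.
      etransitivity; [apply (RInt_plus (V := R_CompleteNormedModule)); apply cts_ex_RInt; cts_tac |].
      f_equal; apply (RInt_scal (V := R_CompleteNormedModule)); apply cts_ex_RInt; cts_tac.
    - etransitivity; [apply (RInt_plus (V := R_CompleteNormedModule)); apply cts_ex_RInt; cbv beta; [cts_tac |] |].
      + apply (cts_mult (fun _ => s)); cts_tac.
      + rewrite (RInt_scal (V := R_CompleteNormedModule) (fun x => RInt (fun y => a' (x, y) ^ 2) 0 h))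
          by (apply cts_ex_RInt; cts_tac).
        rewrite !(RInt_const (V := R_CompleteNormedModule)).
        change ((L - 0) * ((h - 0) * s ^ 3) + s * RInt (fun x => RInt (fun y => a' (x, y) ^ 2) 0 h) 0 L
          = s ^ 3 * L * h + s * RInt (fun x => RInt (fun y => a' (x, y) ^ 2) 0 h) 0 L).
        ring. }
  rewrite H1, H2.
  apply RInt_le; [exact HL | apply cts_ex_RInt; cts_tac | apply cts_ex_RInt; cts_tac | intros x _].
  apply RInt_le; [exact Hh | apply cts_ex_RInt; cts_tac | apply cts_ex_RInt; cts_tac | intros y _].
  generalize (a' (x, y)); intros z.
  apply Rle_trans with (2 * (s ^ 2 * Rabs z)).
  - apply Rle_trans with (Rabs (- (2 * p) * z)); [apply Rle_abs |].
    rewrite Rabs_mult, Rabs_Ropp, Rabs_mult, (Rabs_right 2) by lra.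
    rewrite Rmult_assoc; apply Rmult_le_compat_l; [lra |].
    apply Rmult_le_compat_r; [apply Rabs_pos | exact Hp].
  - rewrite <- (pow2_abs z).
    assert (0 <= s * (s - Rabs z) ^ 2) by (apply Rmult_le_pos; [exact Hs | apply pow2_ge_0]).
    nra.
Qed.

(** * The energy flux and its derivative *)

(* The flux in direction [j] whose divergence is [d/dt |u|^2 + 2 nu |grad u|^2] up to the mean pressure gradient; [U], [V] stand for the velocity and its [j]-derivative. *)
Definition flux (nu : R) (j : axis) (U V : axis -> R) (Q : R) : R :=
  2 * nu * sum3 (fun k => U k * V k) - U j * sum3 (fun k => U k ^ 2) - 2 * (U j * Q).

(** The product rule applied to [flux], with [W] for the second derivatives of the velocity and [q]
    for the derivative of [Q]. *)
Definition dflux (nu : R) (j : axis) (U V W : axis -> R) (Q q : R) : R :=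
  2 * nu * sum3 (fun k => V k ^ 2 + U k * W k)
  - (V j * sum3 (fun k => U k ^ 2) + U j * sum3 (fun k => 2 * (U k * V k)))
  - 2 * (V j * Q + U j * q).

Lemma is_derive_flux (nu : R) (j : axis) (U V : axis -> R -> R) (W : axis -> R)
    (Q : R -> R) (q x : R) :
  (forall k, is_derive (U k) x (V k x)) -> (forall k, is_derive (V k) x (W k)) ->
  is_derive Q x q ->
  is_derive (fun y => flux nu j (fun k => U k y) (fun k => V k y) (Q y)) x
    (dflux nu j (fun k => U k x) (fun k => V k x) W (Q x) q).
Proof.
  intros HU HV HQ; unfold flux, dflux, sum3.
  assert (DU : forall k, Derive (fun y => U k y) x = V k x) by (intros k; apply is_derive_unique, HU).
  assert (DV : forall k, Derive (fun y => V k y) x = W k) by (intros k; apply is_derive_unique, HV).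
  assert (DQ : Derive (fun y => Q y) x = q) by (apply is_derive_unique, HQ).
  assert (EU : forall k, ex_derive (fun y => U k y) x) by (intros k; eexists; apply HU).
  assert (EV : forall k, ex_derive (fun y => V k y) x) by (intros k; eexists; apply HV).
  assert (EQ : ex_derive (fun y => Q y) x) by (eexists; apply HQ).
  auto_derive; [repeat split; auto |].
  rewrite !DU, !DV, DQ; ring.
Qed.

Lemma is_derive_sum3_sqr (U V : axis -> R -> R) (x : R) :
  (forall k, is_derive (U k) x (V k x)) ->
  is_derive (fun y => sum3 (fun k => U k y ^ 2)) x (sum3 (fun k => 2 * (U k x * V k x))).
Proof.
  intros HU; unfold sum3.
  assert (DU : forall k, Derive (fun y => U k y) x = V k x) by (intros k; apply is_derive_unique, HU).
  assert (EU : forall k, ex_derive (fun y => U k y) x) by (intros k; eexists; apply HU).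
  auto_derive; [repeat split; auto |].
  rewrite !DU; ring.
Qed.

(** * Regularity and periodicity of the fields and of the pressure gradient *)

Section Class.
Variables (nu h Pi1 Pi2 : R).
Hypotheses (hnu : 0 < nu) (hh : 0 < h) (hPi1 : 0 < Pi1) (hPi2 : 0 < Pi2).
Variables (u : axis -> spacetime -> R) (P : spacetime -> R) (pbar : R).
Hypothesis hu : in_class nu h Pi1 Pi2 u P pbar.
Variable t : R.

Let D (c : coord) (k : axis) : spacetime -> R := partial_deriv h c (u k).
Let D2 (j k : axis) : spacetime -> R := partial_deriv h j (D j k).
Let G (k : axis) : spacetime -> R := partial_deriv h k P.

Lemma is_partial_u (c : coord) (k : axis) (p : spacetime) :
  slab h p -> is_partial h c (u k) p (D c k p).
Proof.
  intros Hp; apply partial_deriv_correct; [exact hh | exact Hp |].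
  apply (proj2 (class_smooth _ _ _ _ _ _ _ hu k 1%nat) c), Hp.
Qed.

Lemma is_partial_D (j k : axis) (p : spacetime) :
  slab h p -> is_partial h j (D j k) p (D2 j k p).
Proof.
  intros Hp; apply partial_deriv_correct; [exact hh | exact Hp |].
  apply (proj2 (proj2 (proj2 (class_smooth _ _ _ _ _ _ _ hu k 2%nat) j)) j), Hp.
Qed.

Lemma is_partial_P (k : axis) (p : spacetime) :
  slab h p -> is_partial h k P p (G k p).
Proof.
  intros Hp; apply partial_deriv_correct; [exact hh | exact Hp |].
  apply (class_navier_stokes _ _ _ _ _ _ _ hu p Hp).
Qed.

Lemma cts_u (k : axis) : cts (fun p => u k (slab_proj h p)).
Proof. apply cts_slab_proj, (class_smooth _ _ _ _ _ _ _ hu k 0%nat); exact hh. Qed.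

Lemma cts_D (c : coord) (k : axis) : cts (fun p => D c k (slab_proj h p)).
Proof.
  apply cts_slab_proj; [exact hh |].
  apply (proj2 (proj2 (class_smooth _ _ _ _ _ _ _ hu k 1%nat) c)).
Qed.

Lemma cts_D2 (j k : axis) : cts (fun p => D2 j k (slab_proj h p)).
Proof.
  apply cts_slab_proj; [exact hh |].
  apply (proj2 (proj2 (proj2 (proj2 (class_smooth _ _ _ _ _ _ _ hu k 2%nat) j)) j)).
Qed.

(** Solved for the pressure gradient, the equation lets [G] inherit continuity and periodicity from
    the derivatives of [u]. *)
Lemma momentum (k : axis) (p : spacetime) : slab h p ->
  G k p = nu * sum3 (fun j => D2 j k p) - D Time k p - sum3 (fun j => u j p * D j k p).
Proof.
  intros Hp.
  destruct (proj1 (class_navier_stokes _ _ _ _ _ _ _ hu p Hp) k) as [_ H].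
  unfold G, D2, D; lra.
Qed.

Lemma divergence_free (p : spacetime) : slab h p -> sum3 (fun k => D k k p) = 0.
Proof. intros Hp; apply (class_navier_stokes _ _ _ _ _ _ _ hu p Hp). Qed.

Lemma cts_G (k : axis) : cts (fun p => G k (slab_proj h p)).
Proof.
  set (U j p := u j (slab_proj h p)).
  set (V c j p := D c j (slab_proj h p)).
  set (W j p := D2 j k (slab_proj h p)).
  assert (HU : forall j, cts (U j)) by exact cts_u.
  assert (HT : cts (V Time k)) by exact (cts_D Time k).
  assert (HV : forall j : axis, cts (V j k)) by (intros j; exact (cts_D j k)).
  assert (HW : forall j, cts (W j)) by (intros j; exact (cts_D2 j k)).
  assert (H : cts (fun p => nu * sum3 (fun j => W j p) - V Time k p - sum3 (fun j => U j p * V j k p))).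
  { cts_tac; apply HV. }
  intros p; refine (continuous_ext _ _ _ _ (H p)).
  intros q; symmetry; apply momentum, slab_slab_proj, hh.
Qed.

Lemma G_periodic (i : axis) (L : R) : i <> X3 ->
  (forall k, periodic h i L (u k)) -> forall k, periodic h i L (G k).
Proof.
  intros Hi Hper.
  assert (HD : forall c k, periodic h i L (D c k)).
  { intros c k; apply partial_deriv_periodic; auto.
    intros p Hp; eexists; apply is_partial_u, Hp. }
  assert (HD2 : forall j k, periodic h i L (D2 j k)).
  { intros j k; apply partial_deriv_periodic; auto.
    intros p Hp; eexists; apply is_partial_D, Hp. }
  intros k p Hp; rewrite !momentum by (try apply slab_shift; assumption).
  unfold sum3; rewrite !HD, !HD2, !Hper by exact Hp; reflexivity.
Qed.

(** The gradient of [P] is periodic, so the difference of [P] and its translate has zero gradient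
    and equals its value at the origin. *)
Lemma pressure_jump_const (i : axis) (L : R) : i <> X3 ->
  (forall k, periodic h i L (u k)) ->
  forall x1 x2 x3, 0 <= x3 <= h ->
  P (shift i L (x1, x2, x3, t)) - P (x1, x2, x3, t) = pressure_jump i L P t.
Proof.
  intros Hi Hper x1 x2 x3 Hx3.
  apply (const_of_gradient0 h t (fun p => P (shift i L p) - P p) (fun _ _ => 0) hh);
    [intros; apply cts_const | | exact Hx3 | reflexivity].
  intros k p Hp.
  rewrite <- (Rminus_diag (G k p)); rewrite <- (G_periodic i L Hi Hper k p Hp) at 1.
  apply (is_partial_minus h k (fun q => P (shift i L q)) P p); [| apply is_partial_P, Hp].
  apply is_partial_shift; [exact Hi |].
  apply is_partial_P, slab_shift; assumption.
Qed.

(** * The mean pressure gradient and the periodic part of the pressure *)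

(** The slope of the linear part of the pressure. Nothing is removed in the vertical direction,
    where no periodicity is sought. *)
Let b (j : axis) : R :=
  match j with
  | X1 => pressure_jump X1 Pi1 P t / Pi1
  | X2 => pressure_jump X2 Pi2 P t / Pi2
  | X3 => 0
  end.

(* Subtracting the mean pressure gradient from the pressure at time [t] leaves a function that is periodic in [x1] and [x2]; the time is frozen because [P] need not be continuous in time. *)
Let Q (p : spacetime) : R :=
  P (fst (fst p), clamp h (snd (fst p)), t) - (b X1 * fst (fst (fst p)) + b X2 * snd (fst (fst p))).

Lemma cts_Q : cts Q.
Proof.
  assert (H := cts_of_gradient h t P G hh cts_G is_partial_P).
  unfold Q; apply (cts_minus _ _ H); cts_tac.
Qed.

Lemma Q_periodic1 (x2 x3 : R) : Q (Pi1, x2, x3, t) = Q (0, x2, x3, t).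
Proof.
  assert (H := pressure_jump_const X1 Pi1 ltac:(discriminate)
    (fun k => proj1 (class_periodic _ _ _ _ _ _ _ hu k)) 0 x2 _ (clamp_bounds h x3 hh)).
  simpl in H; rewrite Rplus_0_l in H.
  unfold Q, b; simpl; rewrite <- H; field; lra.
Qed.

Lemma Q_periodic2 (x1 x3 : R) : Q (x1, Pi2, x3, t) = Q (x1, 0, x3, t).
Proof.
  assert (H := pressure_jump_const X2 Pi2 ltac:(discriminate)
    (fun k => proj2 (class_periodic _ _ _ _ _ _ _ hu k)) x1 0 _ (clamp_bounds h x3 hh)).
  simpl in H; rewrite Rplus_0_l in H.
  unfold Q, b; simpl; rewrite <- H; field; lra.
Qed.

(** * The flux of the flow and the vanishing of its divergence integral *)

Let A (j : axis) (p : spacetime) : R :=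
  flux nu j (fun k => u k (slab_proj h p)) (fun k => D j k (slab_proj h p)) (Q p).

Let dA (j : axis) (p : spacetime) : R :=
  dflux nu j (fun k => u k (slab_proj h p)) (fun k => D j k (slab_proj h p))
    (fun k => D2 j k (slab_proj h p)) (Q p) (G j (slab_proj h p) - b j).

Lemma cts_A (j : axis) : cts (A j).
Proof.
  assert (HQ := cts_Q).
  set (U k p := u k (slab_proj h p)). assert (HU : forall k, cts (U k)) by exact cts_u.
  set (V k p := D j k (slab_proj h p)). assert (HV : forall k, cts (V k)) by exact (cts_D j).
  change (cts (fun p => flux nu j (fun k => U k p) (fun k => V k p) (Q p))).
  unfold flux; cts_tac; try apply HU; try apply HV; exact HQ.
Qed.

Lemma cts_dA (j : axis) : cts (dA j).
Proof.
  assert (HQ := cts_Q).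
  set (U k p := u k (slab_proj h p)). assert (HU : forall k, cts (U k)) by exact cts_u.
  set (V k p := D j k (slab_proj h p)). assert (HV : forall k, cts (V k)) by exact (cts_D j).
  set (W k p := D2 j k (slab_proj h p)). assert (HW : forall k, cts (W k)) by exact (cts_D2 j).
  set (g p := G j (slab_proj h p)). assert (Hg : cts g) by exact (cts_G j).
  change (cts (fun p => dflux nu j (fun k => U k p) (fun k => V k p) (fun k => W k p) (Q p) (g p - b j))).
  unfold dflux; cts_tac; try apply HU; try apply HV; try apply HW; try exact HQ; exact Hg.
Qed.

(** The derivative is written along the line rather than at [p], which is the shape [V k x] that
    [is_derive_flux] expects. *)
Lemma is_derive_field (f g : spacetime -> R) (j : axis) (p : spacetime) :
  two_sided h j p -> is_partial h j f p (g p) ->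
  is_derive (fun y => f (set_coord j p y)) (coord_of j p) (g (set_coord j p (coord_of j p))).
Proof. intros Hp Hf; rewrite set_coord_of; apply (is_partial_is_derive h); assumption. Qed.

(** The point must lie at time [t], since [Q] evaluates the pressure at this frozen time. *)
Lemma is_derive_A (j : axis) (p : spacetime) : coord_of Time p = t -> two_sided h j p ->
  is_derive (fun y => A j (set_coord j p y)) (coord_of j p) (dA j p).
Proof.
  intros Ht Hp.
  assert (Hs := proj1 Hp).
  (* Near the base point the line stays in the slab, so the clamps drop out and the plain fields can
     be differentiated. *)
  apply (is_derive_ext_loc (fun y => flux nu j (fun k => u k (set_coord j p y))
    (fun k => D j k (set_coord j p y))
    (P (set_coord j p y) - (b X1 * coord_of X1 (set_coord j p y) + b X2 * coord_of X2 (set_coord j p y))))).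
  - assert (Hloc : locally (coord_of j p) (fun y => slab h (set_coord j p y))).
    { destruct p as [[[x1 x2] x3] s]; destruct j; try (apply filter_forall; intros y; exact Hs).
      apply (filter_imp (fun z => 0 < z < h)); [intros z Hz; simpl; lra |].
      apply (open_and _ _ (open_gt 0) (open_lt h)), (proj2 Hp eq_refl). }
    revert Hloc; apply filter_imp; intros y Hy.
    unfold A; rewrite slab_proj_id by exact Hy.
    f_equal; unfold Q; revert Hy; destruct p as [[[x1 x2] x3] s]; simpl in Ht; subst s.
    destruct j; simpl; intros Hy; rewrite clamp_id by exact Hy; reflexivity.
  - assert (HdQ : is_derive (fun y => P (set_coord j p y) - (b X1 * coord_of X1 (set_coord j p y) + b X2 * coord_of X2 (set_coord j p y)))
      (coord_of j p) (G j p - b j)).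
    { apply (is_derive_minus (fun y => P (set_coord j p y))).
      - apply (is_partial_is_derive h); [exact Hp | apply is_partial_P, Hs].
      - destruct p as [[[x1 x2] x3] s]; destruct j; simpl; auto_derive; trivial; unfold b; ring. }
    evar_last.
    + apply (is_derive_flux nu j (fun k y => u k (set_coord j p y)) (fun k y => D j k (set_coord j p y))
        (fun k => D2 j k p) _ _ _ (fun k => is_derive_field (u k) (D j k) j p Hp (is_partial_u j k p Hs))
        (fun k => is_partial_is_derive h j (D j k) p _ Hp (is_partial_D j k p Hs)) HdQ).
    + unfold dA; rewrite slab_proj_id by exact Hs; rewrite set_coord_of.
      f_equal; unfold Q; destruct p as [[[x1 x2] x3] s]; simpl in *; subst s.
      rewrite clamp_id by exact Hs; reflexivity.
Qed.

(** The projection is idempotent. Together with [dA_slab_proj] this carries horizontal derivatives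
    from the slab to all heights, as [int_box_d1] and [int_box_d2] ask. *)
Lemma A_slab_proj (j : axis) (p : spacetime) : A j (slab_proj h p) = A j p.
Proof.
  unfold A, Q; rewrite slab_proj_id by apply slab_slab_proj, hh.
  unfold slab_proj; simpl; rewrite (clamp_id h (clamp h _)) by apply clamp_bounds, hh; reflexivity.
Qed.

Lemma dA_slab_proj (j : axis) (p : spacetime) : dA j (slab_proj h p) = dA j p.
Proof.
  unfold dA, Q; rewrite slab_proj_id by apply slab_slab_proj, hh.
  unfold slab_proj; simpl; rewrite (clamp_id h (clamp h _)) by apply clamp_bounds, hh; reflexivity.
Qed.

(** Horizontally the flux is periodic, because [u], its derivatives and [Q] are. Vertically every
    term of the flux has a velocity factor, which vanishes at both walls. *)
Lemma int_box_dA (j : axis) : int_box Pi1 Pi2 h (dA j) t = 0.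
Proof.
  assert (Hper : forall i L, i <> X3 -> (forall k, periodic h i L (u k)) ->
    forall x1 x2 x3 k, let p := slab_proj h (x1, x2, x3, t) in
      u k (shift i L p) = u k p /\ forall j, D j k (shift i L p) = D j k p).
  { intros i L Hi HL x1 x2 x3 k p.
    assert (Hp : slab h p) by apply slab_slab_proj, hh.
    split; [apply HL, Hp | intros l; apply partial_deriv_periodic; auto].
    intros q Hq; eexists; apply is_partial_u, Hq. }
  destruct j.
  - apply (int_box_d1 Pi1 Pi2 h (A X1)); [exact hPi1 | apply cts_A | apply cts_dA | |].
    + intros x1 x2 x3; rewrite <- dA_slab_proj.
      apply (is_derive_ext (fun y => A X1 (slab_proj h (y, x2, x3, t))));
        [intros y; apply A_slab_proj |].
      apply (is_derive_A X1 (slab_proj h (x1, x2, x3, t))); [reflexivity |].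
      split; [apply slab_slab_proj, hh | discriminate].
    + intros x2 x3; unfold A, flux, sum3; rewrite Q_periodic1.
      assert (H := Hper X1 Pi1 ltac:(discriminate)
        (fun k => proj1 (class_periodic _ _ _ _ _ _ _ hu k)) 0 x2 x3).
      simpl in H; rewrite Rplus_0_l in H.
      unfold slab_proj in *; simpl in *.
      rewrite !(fun k => proj1 (H k)), !(fun k => proj2 (H k) _); reflexivity.
  - apply (int_box_d2 Pi1 Pi2 h (A X2)); [exact hPi2 | apply cts_A | apply cts_dA | |].
    + intros x1 x2 x3; rewrite <- dA_slab_proj.
      apply (is_derive_ext (fun y => A X2 (slab_proj h (x1, y, x3, t))));
        [intros y; apply A_slab_proj |].
      apply (is_derive_A X2 (slab_proj h (x1, x2, x3, t))); [reflexivity |].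
      split; [apply slab_slab_proj, hh | discriminate].
    + intros x1 x3; unfold A, flux, sum3; rewrite Q_periodic2.
      assert (H := Hper X2 Pi2 ltac:(discriminate)
        (fun k => proj2 (class_periodic _ _ _ _ _ _ _ hu k)) x1 0 x3).
      simpl in H; rewrite Rplus_0_l in H.
      unfold slab_proj in *; simpl in *.
      rewrite !(fun k => proj1 (H k)), !(fun k => proj2 (H k) _); reflexivity.
  - apply (int_box_d3 Pi1 Pi2 h (A X3)); [exact hh | apply cts_A | apply cts_dA | |].
    + intros x1 x2 x3 Hx3; apply (is_derive_A X3 (x1, x2, x3, t)); [reflexivity |].
      split; [simpl; lra | intros _; exact Hx3].
    + intros x1 x2; unfold A, slab_proj; simpl; rewrite !clamp_id by lra.
      unfold flux, sum3.
      rewrite !(proj1 (class_no_slip _ _ _ _ _ _ _ hu _ _ _ _)), !(proj2 (class_no_slip _ _ _ _ _ _ _ hu _ _ _ _)).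
      ring.
Qed.

(** * The energy balance *)

Let de (p : spacetime) : R := sum3 (fun k => 2 * (u k (slab_proj h p) * D Time k (slab_proj h p))).

Lemma cts_de : cts de.
Proof.
  set (U k p := u k (slab_proj h p)). assert (HU : forall k, cts (U k)) by exact cts_u.
  set (V k p := D Time k (slab_proj h p)). assert (HV : forall k, cts (V k)) by exact (cts_D Time).
  change (cts (fun p => sum3 (fun k => 2 * (U k p * V k p)))).
  cts_tac.
Qed.

Lemma is_derive_energy :
  is_derive (int_box Pi1 Pi2 h (energy_density u)) t (int_box Pi1 Pi2 h de t).
Proof.
  set (U k p := u k (slab_proj h p)). assert (HU : forall k, cts (U k)) by exact cts_u.
  apply (is_derive_ext (int_box Pi1 Pi2 h (fun p => sum3 (fun k => U k p ^ 2)))).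
  - intros s; apply int_box_ext; [exact hh |]; intros x1 x2 x3 Hx3.
    unfold U; rewrite slab_proj_id by exact Hx3; reflexivity.
  - apply is_derive_int_box; [cts_tac; apply HU | exact cts_de |].
    intros p.
    assert (Hs := slab_slab_proj h p hh).
    assert (Hd : forall k, is_derive (fun s => U k (set_coord Time p s)) (coord_of Time p)
              (D Time k (slab_proj h p))).
    { intros k; destruct p as [[[x1 x2] x3] s].
      apply (is_partial_is_derive h Time (u k) (slab_proj h (x1, x2, x3, s))).
      - split; [exact Hs | discriminate].
      - apply is_partial_u, Hs. }
    evar_last.
    + apply (is_derive_sum3_sqr (fun k s => U k (set_coord Time p s))
        (fun k _ => D Time k (slab_proj h p))), Hd.
    + rewrite set_coord_of; reflexivity.
Qed.

Lemma energy_identity :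
  int_box Pi1 Pi2 h de t
  + 2 * nu * int_box Pi1 Pi2 h (fun p => sum3 (fun k => sum3 (fun l => partial_deriv h l (u k) p ^ 2))) t
  = - (2 * (b X1 * int_box Pi1 Pi2 h (fun p => u X1 (slab_proj h p)) t
            + b X2 * int_box Pi1 Pi2 h (fun p => u X2 (slab_proj h p)) t)).
Proof.
  set (U k p := u k (slab_proj h p)). assert (HU : forall k, cts (U k)) by exact cts_u.
  set (V (l k : axis) p := D l k (slab_proj h p)). assert (HV : forall l k, cts (V l k)) by exact cts_D.
  set (N p := sum3 (fun k => sum3 (fun l => V l k p ^ 2))).
  assert (HN : cts N) by (unfold N; cts_tac; apply HV).
  rewrite (int_box_ext _ _ _ (fun p => sum3 (fun k => sum3 (fun l => partial_deriv h l (u k) p ^ 2))) N t hh)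
    by (intros; unfold N, V; rewrite slab_proj_id by assumption; reflexivity).
  assert (H1 := cts_dA X1); assert (H2 := cts_dA X2); assert (H3 := cts_dA X3); assert (He := cts_de).
  (* The integrand is the sum of the three [dA j]: the momentum equation turns the viscous,
     convective and pressure terms into the time derivative, and incompressibility removes the terms
     multiplied by the divergence. *)
  assert (Hsum : int_box Pi1 Pi2 h (fun p => (de p + 2 * nu * N p) + (2 * b X1 * U X1 p + 2 * b X2 * U X2 p)) t = 0).
  { rewrite (int_box_ext _ _ _ _ (fun p => (dA X1 p + dA X2 p) + dA X3 p) t hh).
    - rewrite !int_box_plus, !int_box_dA by cts_tac; ring.
    - intros x1 x2 x3 Hx3.
      unfold de, N, U, V, dA, dflux; rewrite slab_proj_id by exact Hx3.
      generalize (divergence_free (x1, x2, x3, t) Hx3).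
      rewrite !momentum by exact Hx3.
      unfold sum3, b; intros Hdiv.
      (* The divergence constraint is used to eliminate one diagonal derivative, after which the
         equality is a polynomial identity. *)
      replace (D X3 X3 (x1, x2, x3, t)) with (- D X1 X1 (x1, x2, x3, t) - D X2 X2 (x1, x2, x3, t)) by lra.
      ring. }
  rewrite !int_box_plus, !int_box_scal in Hsum by cts_tac.
  change (int_box Pi1 Pi2 h de t + 2 * nu * int_box Pi1 Pi2 h N t
    = - (2 * (b X1 * int_box Pi1 Pi2 h (U X1) t + b X2 * int_box Pi1 Pi2 h (U X2) t))).
  lra.
Qed.
End Class.

Theorem proposition4p1 (nu h Pi1 Pi2 : R)
    (hnu : 0 < nu) (hh : 0 < h) (hPi1 : 0 < Pi1) (hPi2 : 0 < Pi2)
    (u : axis -> spacetime -> R) (P : spacetime -> R) (pbar : R)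
    (hu : in_class nu h Pi1 Pi2 u P pbar)
    (hu3 : forall p : spacetime, slab h p -> u X3 p = 0)
    (t : R) :
  ex_derive (int_box Pi1 Pi2 h (energy_density u)) t /\
  Derive (int_box Pi1 Pi2 h (energy_density u)) t
  + 2 * nu * int_box Pi1 Pi2 h
      (fun p => sum3 (fun k => sum3 (fun l => partial_deriv h l (u k) p ^ 2))) t
  - nu * int_box Pi1 Pi2 h
      (fun p => partial_deriv h X1 (u X1) p ^ 2 + partial_deriv h X2 (u X2) p ^ 2) t
  <= pbar ^ 2 * Pi1 * Pi2 * h / (6 * nu)
     + Rpower pbar (3 / 2) * (Pi1 + Pi2) * h
     + Rpower pbar (1 / 2) *
       (RInt (fun x2 => RInt (fun x3 => avg1 Pi1 (u X1) x2 x3 t ^ 2) 0 h) 0 Pi2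
        + RInt (fun x1 => RInt (fun x3 => avg2 Pi2 (u X2) x1 x3 t ^ 2) 0 h) 0 Pi1).
Proof.
  assert (HE := is_derive_energy nu h Pi1 Pi2 hh u P pbar hu t); cbv zeta in HE.
  split; [eexists; exact HE |].
  rewrite (is_derive_unique _ _ _ HE).
  assert (Hid := energy_identity nu h Pi1 Pi2 hh hPi1 hPi2 u P pbar hu t); cbv beta zeta iota in Hid.
  rewrite Hid; clear HE Hid.
  destruct (class_jump _ _ _ _ _ _ _ hu t) as [[Hp0 Hp1] Hp2].
  assert (Hpbar : 0 < pbar) by lra.
  (* With this [s] the powers of [pbar] in the claim are [s] and [s ^ 3], and the bound on the jumps
     reads [|p_j| <= s ^ 2]. *)
  set (s := sqrt pbar).
  assert (Hs0 : 0 <= s) by apply sqrt_pos.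
  assert (Hs2 : s ^ 2 = pbar) by (apply pow2_sqrt; lra).
  assert (Hr1 : Rpower pbar (1 / 2) = s).
  { replace (1 / 2) with (/ 2) by lra; apply Rpower_sqrt, Hpbar. }
  assert (Hr3 : Rpower pbar (3 / 2) = s ^ 3).
  { replace (3 / 2) with (1 + 1 / 2) by lra.
    rewrite Rpower_plus, Rpower_1, Hr1 by exact Hpbar. rewrite <- Hs2 at 1; ring. }
  rewrite Hr1, Hr3.
  set (U k p := u k (slab_proj h p)).
  assert (HU : forall k, cts (U k)) by exact (cts_u nu h Pi1 Pi2 hh u P pbar hu).
  change (fun p => u X1 (slab_proj h p)) with (U X1).
  change (fun p => u X2 (slab_proj h p)) with (U X2).
  (* The averages are rewritten with the clamped velocity, which is continuous everywhere; on the
     range of integration nothing changes. *)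
  assert (Ha1 : RInt (fun x2 => RInt (fun x3 => avg1 Pi1 (u X1) x2 x3 t ^ 2) 0 h) 0 Pi2
    = RInt (fun x2 => RInt (fun x3 => avg1 Pi1 (U X1) x2 x3 t ^ 2) 0 h) 0 Pi2).
  { apply RInt_ext; intros x2 _; apply RInt_ext; intros x3 Hx3.
    rewrite Rmin_left, Rmax_right in Hx3 by lra.
    unfold avg1, U, slab_proj; simpl; rewrite clamp_id by lra; reflexivity. }
  assert (Ha2 : RInt (fun x1 => RInt (fun x3 => avg2 Pi2 (u X2) x1 x3 t ^ 2) 0 h) 0 Pi1
    = RInt (fun x1 => RInt (fun x3 => avg2 Pi2 (U X2) x1 x3 t ^ 2) 0 h) 0 Pi1).
  { apply RInt_ext; intros x2 _; apply RInt_ext; intros x3 Hx3.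
    rewrite Rmin_left, Rmax_right in Hx3 by lra.
    unfold avg2, U, slab_proj; simpl; rewrite clamp_id by lra; reflexivity. }
  rewrite Ha1, Ha2, int_box_avg1, (int_box_avg2 _ _ _ (U X2)) by auto.
  assert (Hpos : 0 <= nu * int_box Pi1 Pi2 h
      (fun p => partial_deriv h X1 (u X1) p ^ 2 + partial_deriv h X2 (u X2) p ^ 2) t).
  { set (V k p := partial_deriv h (Space k) (u k) (slab_proj h p)).
    assert (HV : forall k, cts (V k)).
    { intros k; exact (cts_D nu h Pi1 Pi2 hh u P pbar hu k k). }
    rewrite (int_box_ext _ _ _ _ (fun p => V X1 p ^ 2 + V X2 p ^ 2) t hh)
      by (intros; unfold V; rewrite slab_proj_id by assumption; reflexivity).
    apply Rmult_le_pos; [lra |].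
    apply int_box_ge0; [lra | lra | lra | cts_tac |].
    intros p; apply Rplus_le_le_0_compat; apply pow2_ge_0. }
  assert (Hpos2 : 0 <= pbar ^ 2 * Pi1 * Pi2 * h / (6 * nu)).
  { apply Rdiv_le_0_compat; [| lra].
    repeat apply Rmult_le_pos; try lra; apply pow2_ge_0. }
  (* The average over [x1] leaves an integral over [x2] and [x3], so the first jump is paired with
     the length [Pi2], and the second with [Pi1]. *)
  assert (Hy1 := RInt_young (fun x2 x3 => avg1 Pi1 (U X1) x2 x3 t) (pressure_jump X1 Pi1 P t) s Pi2 h
     ltac:(lra) ltac:(lra) Hs0).
  assert (Hy2 := RInt_young (fun x1 x3 => avg2 Pi2 (U X2) x1 x3 t) (pressure_jump X2 Pi2 P t) s Pi1 h
     ltac:(lra) ltac:(lra) Hs0).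
  rewrite Hs2 in Hy1, Hy2.
  assert (H1 := Hy1 ltac:(apply Rabs_le; lra) ltac:(unfold avg1; cts_tac)).
  assert (H2 := Hy2 Hp2 ltac:(unfold avg2; cts_tac)).
  clear Hy1 Hy2 Ha1 Ha2.
  set (I1 := RInt (fun x2 => RInt (fun x3 => avg1 Pi1 (U X1) x2 x3 t) 0 h) 0 Pi2) in *.
  set (I2 := RInt (fun x1 => RInt (fun x3 => avg2 Pi2 (U X2) x1 x3 t) 0 h) 0 Pi1) in *.
  (* The period in the mean gradient cancels the one produced by averaging, leaving the bare jump to
     which the Young bound applies. *)
  replace (pressure_jump X1 Pi1 P t / Pi1 * (Pi1 * I1)) with (pressure_jump X1 Pi1 P t * I1) by (field; lra).
  replace (pressure_jump X2 Pi2 P t / Pi2 * (Pi2 * I2)) with (pressure_jump X2 Pi2 P t * I2) by (field; lra).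
  lra.
Qed.
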